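(* Every GaTEx graph is murky, i.e., the graph and its complement both contain no hole and no induced path $P_6$ on six vertices.
   Context: All graphs are finite, simple and undirected. A galled-tree on a finite nonempty set $X$ is a directed acyclic graph $N=(V,E)$ such that either $V=X=\{x\}$ and $E=\emptyset$, or: (N1) there is a unique root with indegree 0 and outdegree at least 2; (N2) $x\in X$ iff $x$ has outdegree 0 and indegree 1; (N3) every non-root $v\in V\setminus X$ has either indegree 1 and outdegree at least 2, or indegree 2 and outdegree at least 1 (hybrid-vertex); (N4) each biconnected component $C$ of $N$ contains at most one hybrid-vertex whose two in-neighbours both belong to $C$. For $x,y\in X$, $\mathrm{lca}_N(x,y)$ is the (unique) minimal common ancestor of $x,y$. A labeled galled-tree $(N,t)$ has $t:V\to\{0,1,\odot\}$ with $t(x)=\odot$ iff $x\in X$; it explains the graph on $X$ where $\{x,y\}$ is an edge iff $t(\mathrm{lca}_N(x,y))=1$. A graph is GaTEx if it is isomorphic to a graph explained by some labeled galled-tree. A hole is an induced cycle on at least five vertices. *)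

(* Defs.v *)
From mathcomp Require Import all_boot.

Set Implicit Arguments.
Unset Strict Implicit.
Unset Printing Implicit Defensive.

Record sgraph := SGraph {
  vertex :> finType;
  adj : rel vertex;
  adj_sym : symmetric adj;
  adj_irr : irreflexive adj
}.

Definition isomorphic (G H : sgraph) : Prop :=
  exists f : G -> H,
    bijective f /\ forall x y : G, adj (f x) (f y) = adj x y.

(* H is isomorphic to an induced subgraph of G. *)
Definition contains_induced (G H : sgraph) : Prop :=
  exists f : H -> G,
    injective f /\ forall x y : H, adj (f x) (f y) = adj x y.

Definition compl_adj (G : sgraph) : rel G :=
  fun x y => (x != y) && ~~ adj x y.

Lemma compl_adj_sym (G : sgraph) : symmetric (@compl_adj G).
Proof. by move=> x y; rewrite /compl_adj eq_sym adj_sym. Qed.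

Lemma compl_adj_irr (G : sgraph) : irreflexive (@compl_adj G).
Proof. by move=> x; rewrite /compl_adj eqxx. Qed.

Definition complement (G : sgraph) : sgraph :=
  SGraph (@compl_adj_sym G) (@compl_adj_irr G).

Definition path_adj (n : nat) : rel 'I_n :=
  fun i j => (i.+1 == j :> nat) || (j.+1 == i :> nat).

Lemma path_adj_sym (n : nat) : symmetric (@path_adj n).
Proof. by move=> i j; rewrite /path_adj orbC. Qed.

Lemma path_adj_irr (n : nat) : irreflexive (@path_adj n).
Proof. by move=> i; rewrite /path_adj orbb (gtn_eqF (ltnSn i)). Qed.

Definition path_graph (n : nat) : sgraph :=
  SGraph (@path_adj_sym n) (@path_adj_irr n).

(* ordS is the successor modulo n; the graph is the cycle C_n for n >= 3. *)
Definition cycle_adj (n : nat) : rel 'I_n :=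
  fun i j => (i != j) && ((ordS i == j) || (ordS j == i)).

Lemma cycle_adj_sym (n : nat) : symmetric (@cycle_adj n).
Proof. by move=> i j; rewrite /cycle_adj eq_sym orbC. Qed.

Lemma cycle_adj_irr (n : nat) : irreflexive (@cycle_adj n).
Proof. by move=> i; rewrite /cycle_adj eqxx. Qed.

Definition cycle_graph (n : nat) : sgraph :=
  SGraph (@cycle_adj_sym n) (@cycle_adj_irr n).

Definition has_hole (G : sgraph) : Prop :=
  exists n : nat, 5 <= n /\ contains_induced G (cycle_graph n).

Definition murky (G : sgraph) : Prop :=
  [/\ ~ has_hole G,
      ~ has_hole (complement G),
      ~ contains_induced G (path_graph 6)
    & ~ contains_induced (complement G) (path_graph 6)].

(* A digraph on V is its arc relation: [e u v] means that (u, v) is an arc. *)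

Definition acyclic (V : finType) (e : rel V) : Prop :=
  forall c : seq V, ucycle e c -> c = [::].

Definition in_nbrs (V : finType) (e : rel V) (v : V) : {set V} :=
  [set u | e u v].

Definition out_nbrs (V : finType) (e : rel V) (v : V) : {set V} :=
  [set w | e v w].

Definition indeg (V : finType) (e : rel V) (v : V) : nat := #|in_nbrs e v|.

Definition outdeg (V : finType) (e : rel V) (v : V) : nat := #|out_nbrs e v|.

Definition hybrid (V : finType) (e : rel V) (v : V) : bool :=
  (indeg e v == 2) && (1 <= outdeg e v).

(* The subgraph induced by A in the underlying undirected graph is connected
   (vacuously so for A empty). *)
Definition connected_in (V : finType) (e : rel V) (A : {set V}) : bool :=
  [forall x in A, forall y in A,
     connect [rel u v | [&& u \in A, v \in A & e u v || e v u]] x y].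

Definition biconnected (V : finType) (e : rel V) (C : {set V}) : bool :=
  connected_in e C && [forall v in C, connected_in e (C :\ v)].

(* Adding edges preserves biconnectedness, so a maximal biconnected subgraph is
   induced and is determined by its vertex set. *)
Definition biconnected_component (V : finType) (e : rel V) (C : {set V}) : bool :=
  maxset (biconnected e) C.

Definition is_root (V : finType) (e : rel V) (r : V) : Prop :=
  [/\ indeg e r = 0, 2 <= outdeg e r & forall v : V, indeg e v = 0 -> v = r].

Definition trivial_tree (V : finType) (e : rel V) (X : {set V}) : Prop :=
  exists x : V,
    [/\ [set: V] = [set x], X = [set x] & forall u v : V, ~~ e u v].

Definition nontrivial_galled_tree (V : finType) (e : rel V) (X : {set V}) : Prop :=
  exists r : V,
    [/\ is_root e r,
        forall x : V, (x \in X) <-> (outdeg e x = 0 /\ indeg e x = 1),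
        forall v : V, v \notin X -> v <> r ->
          (indeg e v = 1 /\ 2 <= outdeg e v) \/
          (indeg e v = 2 /\ 1 <= outdeg e v)
      & forall C : {set V}, biconnected_component e C ->
          #|[set v in C | hybrid e v && (in_nbrs e v \subset C)]| <= 1].

Definition galled_tree (V : finType) (e : rel V) (X : {set V}) : Prop :=
  [/\ X != set0, acyclic e &
      trivial_tree e X \/ nontrivial_galled_tree e X].

Definition common_ancestor (V : finType) (e : rel V) (x y z : V) : bool :=
  connect e z x && connect e z y.

Definition is_lca (V : finType) (e : rel V) (x y z : V) : bool :=
  common_ancestor e x y z &&
  [forall w, common_ancestor e x y w ==> connect e z w ==> (w == z)].

(* In a galled-tree any two leaves have exactly one minimal common ancestor, so
   the value is then [Some] of it; [None] only makes the function total. *)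
Definition lca (V : finType) (e : rel V) (x y : V) : option V :=
  [pick z | is_lca e x y z].

Inductive label := Zero | One | Odot.

Definition is_one (l : label) : bool := if l is One then true else false.

Definition labeled_galled_tree (V : finType) (e : rel V) (X : {set V})
    (t : V -> label) : Prop :=
  galled_tree e X /\ forall v : V, t v = Odot <-> v \in X.

Definition explained_adj (V : finType) (e : rel V) (X : {set V})
    (t : V -> label) : rel {x : V | x \in X} :=
  fun x y => (x != y) && (if lca e (val x) (val y) is Some z then is_one (t z) else false).

Lemma is_lcaC (V : finType) (e : rel V) (x y : V) :
  is_lca e x y =1 is_lca e y x.
Proof.
have caC z : common_ancestor e x y z = common_ancestor e y x z.
  by rewrite /common_ancestor andbC.
move=> z; rewrite /is_lca caC; congr (_ && _).
by apply: eq_forallb => w; rewrite caC.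
Qed.

Lemma explained_adj_sym (V : finType) (e : rel V) (X : {set V})
  (t : V -> label) : symmetric (@explained_adj V e X t).
Proof.
move=> x y; rewrite /explained_adj eq_sym.
by rewrite /lca (eq_pick (is_lcaC e (val x) (val y))).
Qed.

Lemma explained_adj_irr (V : finType) (e : rel V) (X : {set V})
  (t : V -> label) : irreflexive (@explained_adj V e X t).
Proof. by move=> x; rewrite /explained_adj eqxx. Qed.

Definition explained_graph (V : finType) (e : rel V) (X : {set V})
    (t : V -> label) : sgraph :=
  SGraph (@explained_adj_sym V e X t) (@explained_adj_irr V e X t).

Definition GaTEx (G : sgraph) : Prop :=
  exists (V : finType) (e : rel V) (X : {set V}) (t : V -> label),
    labeled_galled_tree e X t /\ isomorphic G (explained_graph e X t).

(* Main.v *)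
(* The sets of descendants of the vertices of a galled-tree behave like a
   clustering system: all clusters overlapping a given cluster A meet A in the
   same set, no three clusters overlap pairwise, and the adjacency of two leaves
   depends only on the smallest cluster containing both. The first two facts
   hold because two incomparable vertices with a common descendant lie on an
   undirected cycle with a unique sink h, and then have exactly the descendants
   of h in common.

   These properties pass to induced subgraphs and to complements. Let H be a
   graph with such a system and, complementing if necessary, let pairs contained
   in no proper cluster be non-adjacent. If H is connected, its maximal proper
   clusters are just two overlapping sets A and B with union V(H); there is no
   edge between A \ B and B \ A, the intersection of A and B is a module, and no
   induced P4 has an end in this intersection and its other three vertices all
   in A \ B or all in B \ A. No such A and B exist for C5, C6, P6 and their
   complements, and longer holes contain an induced P6. *)

Require Import Defs.
From mathcomp Require Import all_boot.

Set Implicit Arguments.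
Unset Strict Implicit.
Unset Printing Implicit Defensive.

(** * Clustered graphs *)

Section Overlap.
Variable T : finType.
Implicit Types A B C : {set T}.

Definition overlap A B :=
  [&& A :&: B != set0, ~~ (A \subset B) & ~~ (B \subset A)].

Lemma overlapC A B : overlap A B = overlap B A.
Proof. by rewrite /overlap setIC; congr (_ && _); rewrite andbC. Qed.

Lemma overlapI A B x :
  x \in A -> x \in B -> ~~ (A \subset B) -> ~~ (B \subset A) -> overlap A B.
Proof.
move=> xA xB nAB nBA; rewrite /overlap nAB nBA !andbT.
by apply/set0Pn; exists x; rewrite inE xA.
Qed.

End Overlap.

(* F stands for the sets of descendants and M x y for that of lca(x, y). *)
Definition clustered (T : finType) (r : rel T) : Prop :=
  exists (F : {set {set T}}) (M : T -> T -> {set T}),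
  [/\ forall A B C, A \in F -> B \in F -> C \in F ->
        overlap A B -> overlap A C -> A :&: B = A :&: C,
      forall A B C, A \in F -> B \in F -> C \in F ->
        overlap A B -> overlap A C -> overlap B C -> False,
      forall x y, [/\ M x y \in F, x \in M x y & y \in M x y],
      forall x y C, C \in F -> x \in C -> y \in C -> M x y \subset C
    & forall x y x' y', x != y -> x' != y' -> M x y = M x' y' ->
        r x y = r x' y'].

(** Traces of clusters overlap only if the clusters themselves do, so both overlap conditions
    survive restriction. *)
Lemma clustered_induced (T U : finType) (r : rel T) (s : rel U) (f : U -> T) :
  injective f -> (forall x y, r (f x) (f y) = s x y) ->
  clustered r -> clustered s.
Proof.
move=> f_inj rs [F [M [FL F3 MF Mmin rM]]].
have sub_pre (A B : {set T}) : A \subset B -> f @^-1: A \subset f @^-1: B.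
  by exact: preimsetS.
have ov_pre (A B : {set T}) : overlap (f @^-1: A) (f @^-1: B) -> overlap A B.
  case/and3P=> /set0Pn[x]; rewrite !inE => /andP[xA xB] nAB nBA.
  apply: overlapI xA xB _ _; [apply: contra nAB|apply: contra nBA]; exact: sub_pre.
exists [set f @^-1: A | A : {set T} in F], (fun x y => f @^-1: M (f x) (f y)).
split.
- move=> _ _ _ /imsetP[A AF ->] /imsetP[B BF ->] /imsetP[C CF ->].
  by move=> /ov_pre AB /ov_pre AC; rewrite -!preimsetI (FL A B C).
- move=> _ _ _ /imsetP[A AF ->] /imsetP[B BF ->] /imsetP[C CF ->].
  by move=> /ov_pre AB /ov_pre AC /ov_pre BC; apply: (F3 A B C).
- move=> x y; have [MFxy xM yM] := MF (f x) (f y).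
  by rewrite !inE; split=> //; apply: imset_f.
- move=> x y _ /imsetP[C CF ->]; rewrite !inE => xC yC.
  by apply: sub_pre; apply: Mmin.
(* Equal traces come from equal minimal clusters: each contains the pair defining the other, and
   minimality gives both inclusions. *)
move=> x y x' y' nxy nxy' Mxy; rewrite -!rs; apply: rM; rewrite ?(inj_eq f_inj) //.
have [MF1 xM yM] := MF (f x) (f y); have [MF2 xM' yM'] := MF (f x') (f y').
by apply/eqP; rewrite eqEsubset; apply/andP; split; apply: Mmin => //;
   [move/setP/(_ x): Mxy|move/setP/(_ y): Mxy
   |move/setP/(_ x'): Mxy|move/setP/(_ y'): Mxy];
   rewrite !inE ?xM ?yM ?xM' ?yM'.
Qed.

Lemma clustered_compl (T : finType) (r : rel T) :
  clustered r -> clustered (fun x y => (x != y) && ~~ r x y).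
Proof.
move=> [F [M [FL F3 MF Mmin rM]]]; exists F, M; split=> //.
by move=> x y x' y' nxy nxy' Mxy; rewrite nxy nxy' (rM x y x' y').
Qed.

(** For symmetric [r] this is connectedness, phrased through closed sets so that it can be decided
    by running over all subsets. *)
Definition connected_rel (T : finType) (r : rel T) :=
  forall A : {set T}, A != set0 -> (forall x y, x \in A -> r x y -> y \in A) ->
    A = setT.

(** An induced path: for symmetric irreflexive [r] these conditions already force the four vertices
    to be distinct. *)
Definition path4 (T : Type) (r : rel T) (a b c s : T) :=
  [&& r a b, r b c, r c s, ~~ r a c, ~~ r a s & ~~ r b s].

(** Clusters are not mentioned, so a fixed small graph can be tested by enumerating [A] and [B]. *)
Definition split_by (T : finType) (r : rel T) (A B : {set T}) :=
  [/\ [/\ A :|: B = setT, A != setT, B != setT & A :&: B != set0],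
      forall x s s', x \notin A :&: B -> s \in A :&: B -> s' \in A :&: B ->
        r x s = r x s',
      forall x y, x \in A :\: B -> y \in B :\: A -> ~~ r x y
    & forall a b c s, s \in A :&: B ->
        (a \in A :\: B) && (b \in A :\: B) && (c \in A :\: B) ||
        (a \in B :\: A) && (b \in B :\: A) && (c \in B :\: A) ->
        ~~ path4 r a b c s].

(** * Splitting a connected graph by two maximal proper clusters *)

Section Split.
Variables (T : finType) (r : rel T).
Hypothesis rC : symmetric r.
Variables (F : {set {set T}}) (M : T -> T -> {set T}).
Hypothesis FL : forall A B C, A \in F -> B \in F -> C \in F ->
        overlap A B -> overlap A C -> A :&: B = A :&: C.
Hypothesis F3 : forall A B C, A \in F -> B \in F -> C \in F ->
        overlap A B -> overlap A C -> overlap B C -> False.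
Hypothesis MF : forall x y, [/\ M x y \in F, x \in M x y & y \in M x y].
Hypothesis Mmin :
  forall x y C, C \in F -> x \in C -> y \in C -> M x y \subset C.
Hypothesis rM : forall x y x' y', x != y -> x' != y' -> M x y = M x' y' ->
        r x y = r x' y'.

Let MinF x y : M x y \in F. Proof. by case: (MF x y). Qed.
Let Ml x y : x \in M x y. Proof. by case: (MF x y). Qed.
Let Mr x y : y \in M x y. Proof. by case: (MF x y). Qed.

Lemma eq_min_cluster x y x' y' :
  x \in M x' y' -> y \in M x' y' -> x' \in M x y -> y' \in M x y ->
  M x y = M x' y'.
Proof. by move=> *; apply/eqP; rewrite eqEsubset !Mmin. Qed.

Section Sides.
Variables A B : {set T}.
Hypotheses (AF : A \in F) (BF : B \in F) (AB : overlap A B).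

Let nBA : ~~ (B \subset A). Proof. by case/and3P: AB. Qed.

(** [C] cannot contain [B], because [A] does not; so [B] overlaps both [A] and [C] and meets them in
    the same set. *)
Lemma cluster_trace C s x : C \in F -> C \subset A -> s \in A :&: B ->
  s \in C -> x \in C :\: B -> overlap C B /\ C :&: B = A :&: B.
Proof.
rewrite !inE => CF CA /andP[sA sB] sC /andP[xB xC].
have CB : overlap C B.
  apply: overlapI sC sB _ _; first by apply/subsetPn; exists x.
  by apply: contra nBA => /subset_trans; apply.
by split=> //; rewrite ![_ :&: B]setIC; apply: FL => //; rewrite overlapC.
Qed.

(** By [cluster_trace], the minimal cluster of [x] and any point of [A :&: B] contains all of
    [A :&: B]; hence [M x s] and [M x s'] coincide. *)
Lemma side_modular x s s' : x \in A :\: B -> s \in A :&: B -> s' \in A :&: B ->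
  r x s = r x s'.
Proof.
move=> xAB sS s'S.
have sub t t' : t \in A :&: B -> t' \in A :&: B -> t' \in M x t.
  move=> tS t'S; have /setIP[tA tB] := tS; have /setDP[xA xB] := xAB.
  have [|||_] // := @cluster_trace (M x t) t x _ _ tS (Mr x t).
  - exact: Mmin.
  - by rewrite inE xB Ml.
  by move/setP/(_ t'); rewrite t'S => /setIP[].
have neq t : t \in A :&: B -> x != t.
  by case/setIP=> _ tB; apply: contraTneq tB => <-; case/setDP: xAB.
by apply: rM; rewrite ?neq //; apply: eq_min_cluster; rewrite ?Ml ?sub.
Qed.

(* Hence the clusters inside A that meet both A :&: B and A :\: B form a chain. *)
Lemma side_chain C C' s x : C \in F -> C' \in F -> C \subset A -> C' \subset A ->
  s \in A :&: B -> s \in C -> x \in C :\: B -> ~~ overlap C C'.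
Proof.
move=> CF C'F CA C'A sS sC xC; apply/negP=> CC'.
have [CB eqS] := cluster_trace CF CA sS sC xC.
(* [C] overlaps both [B] and [C'], so it meets them equally. A point of [C'] outside [C] is then
   outside [B], so [C'] overlaps [B] as well and three clusters overlap pairwise. *)
have eqI : C :&: C' = A :&: B by rewrite -eqS; apply: FL.
have sC' : s \in C' by move/setP/(_ s): eqI; rewrite sS => /setIP[].
have /and3P[_ _ /subsetPn[z zC' zC]] := CC'.
have zB : z \notin B.
  apply: contra zC => zB; move/setP/(_ z): eqS.
  by rewrite !inE zB (subsetP C'A _ zC') => /andP[].
have zD : z \in C' :\: B by rewrite inE zB.
have [C'B _] := cluster_trace C'F C'A sS sC' zD.
exact: (F3 CF C'F BF).
Qed.

(** By the chain property, a cluster inside [A] that contains [y'] and meets [M s y] must contain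
    [M s y]. So [s] lies in [M y y'] and [y] in [M s y'], which makes these two clusters equal. *)
Lemma side_adj s y y' : s \in A :&: B -> y \in A :\: B -> y' \in A :\: B ->
  y' \notin M s y -> r y y' = r s y'.
Proof.
move=> sS yD y'D y'M.
have /setDP[yA yB] := yD; have /setDP[y'A y'B] := y'D; have /setIP[sA sB] := sS.
have yMD : y \in M s y :\: B by rewrite inE yB Mr.
have sub C z : C \in F -> C \subset A -> z \in M s y -> z \in C -> y' \in C ->
    M s y \subset C.
  move=> CF CA zM zC y'C.
  have:= side_chain (MinF s y) CF (Mmin AF sA yA) CA sS (Ml s y) yMD.
  apply: contraNT => nsub; apply: overlapI zM zC nsub _.
  by apply/subsetPn; exists y'.
have sub1 : M s y \subset M y y'.
  by apply: (sub _ y); rewrite ?MinF ?Mmin ?Ml ?Mr.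
have sub2 : M s y \subset M s y'.
  by apply: (sub _ s); rewrite ?MinF ?Mmin ?Ml ?Mr.
apply: rM.
- by apply: contraNneq y'M => <-; rewrite Mr.
- by apply: contraTneq sB => ->.
by apply: eq_min_cluster; rewrite ?Mr ?(subsetP sub1) ?(subsetP sub2) ?Ml ?Mr.
Qed.

(** By [side_adj], a vertex of the side outside [M s y] sees [y] as it sees [s]. Hence [b] is in
    [M s c] and [c] is in [M s a]. As [b] and [c] see [s] differently, [c] is not in [M s b]; so
    neither is [a], and [a] sees [b] as it sees [s], a contradiction. *)
Lemma side_no_path4 a b c s : s \in A :&: B -> a \in A :\: B -> b \in A :\: B ->
  c \in A :\: B -> ~~ path4 r a b c s.
Proof.
move=> sS aD bD cD; apply/negP=> /and5P[ab bc cs nac /andP[nas nbs]].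
have neq y : y \in A :\: B -> s != y.
  by case/setDP=> _ yB; apply: contraNneq yB => <-; case/setIP: sS.
have up y y' : y \in A :\: B -> y' \in A :\: B -> r s y != r s y' ->
    y' \in M s y -> y \notin M s y'.
  move=> yD y'D nr y'M; apply: contra nr => yM; apply/eqP.
  by apply: rM; rewrite ?neq //; apply: eq_min_cluster; rewrite ?Ml.
have bM : b \in M s c.
  by apply: contraNT nbs => bM; rewrite rC -(side_adj sS cD bD bM) rC.
have cM : c \in M s a.
  by apply: contraNT nac => cM; rewrite (side_adj sS aD cD cM) rC.
have rsc : r s c by rewrite rC.
have rsb : r s b = false by rewrite rC; apply/negbTE.
have rsa : r s a = false by rewrite rC; apply/negbTE.
have cnM : c \notin M s b by apply: up bM; rewrite // rsc rsb.
have aM : a \notin M s b.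
  apply: contra cnM => aM; apply: subsetP cM; exact: Mmin.
by have:= side_adj sS bD aD aM; rewrite rsa rC ab.
Qed.

End Sides.

Hypothesis r_conn : connected_rel r.
Hypothesis T_gt1 : 1 < #|T|.
Hypothesis r_top : forall x y, x != y -> M x y = setT -> ~~ r x y.

Let adj_proper x y : r x y -> M x y != setT \/ x = y.
Proof.
move=> rxy; have [->|nxy] := eqVneq x y; first by right.
by left; apply: contraL rxy => /eqP; apply: r_top.
Qed.

(** Connectedness gives an edge leaving [A], and the minimal cluster of an edge is proper by
    [r_top]. *)
Let exit (A : {set T}) : A != set0 -> A != setT ->
  exists x y, [/\ x \in A, y \notin A, r x y & M x y != setT].
Proof.
move=> A0 AT; have [/existsP[x /existsP[y /and3P[xA yA rxy]]]|none] :=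
  boolP [exists x, exists y, [&& x \in A, y \notin A & r x y]].
  exists x, y; split=> //; have [//|xy] := adj_proper rxy.
  by rewrite -xy xA in yA.
case/eqP: AT; apply: r_conn => // x y xA rxy; apply: contraNT none => yA.
by apply/existsP; exists x; apply/existsP; exists y; rewrite xA yA.
Qed.

Let maximal_proper (A : {set T}) := [/\ A \in F, A != setT &
  forall C, C \in F -> C != setT -> A \subset C -> A = C].

Let maximal_above (C : {set T}) : C \in F -> C != setT ->
  exists2 A, maximal_proper A & C \subset A.
Proof.
move=> CF CT.
have [|A /maxsetP[/andP[AF AT] Amax] CA] :=
  @maxset_exists _ (fun A => (A \in F) && (A != setT)) C; first by rewrite CF.
exists A => //; split=> // C' C'F C'T AC'; apply/esym/Amax => //.
by rewrite C'F.
Qed.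

Let max_overlap (A C : {set T}) x y : maximal_proper A -> C \in F -> C != setT ->
  x \in A -> x \in C -> y \notin A -> y \in C -> overlap A C.
Proof.
move=> [AF AT Amax] CF CT xA xC yA yC; apply: overlapI xA xC _ _.
  by apply/negP=> /(Amax _ CF CT) eqAC; rewrite eqAC yC in yA.
by apply/subsetPn; exists y.
Qed.

Lemma connected_split : exists A B, split_by r A B.
Proof.
have [x0 _] : exists x0 : T, x0 \in T by apply/card_gt0P; exact: ltnW.
(* A singleton is a proper subset, so some edge has a proper minimal cluster; [A] is a maximal
   proper cluster above it, and [B] one above an edge leaving [A]. *)
have [||x1 [y1 [_ _ _ M1T]]] := @exit [set x0].
- by apply/set0Pn; exists x0; rewrite inE.
- by apply: contraTneq T_gt1 => E; rewrite -cardsT -E cards1.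
have [A mA sA] := maximal_above (MinF x1 y1) M1T.
have [AF AT Amax] := mA.
have A0 : A != set0 by apply/set0Pn; exists x1; rewrite (subsetP sA) ?Ml.
have [x [y [xA yA _ MxyT]]] := exit A0 AT.
have [B mB sB] := maximal_above (MinF x y) MxyT.
have [BF BT Bmax] := mB.
have xB : x \in B by rewrite (subsetP sB) ?Ml.
have yB : y \in B by rewrite (subsetP sB) ?Mr.
have AB : overlap A B := max_overlap mA BF BT xA xB yA yB.
have BA : overlap B A by rewrite overlapC.
have S0 : A :&: B != set0 by apply/set0Pn; exists x; rewrite inE xA.
(* An edge leaving the union, say from [A], has a minimal cluster overlapping [A]. It meets [A] in
   [A :&: B], so it overlaps [B] too: three pairwise overlapping clusters. *)
have AUB : A :|: B = setT.
  apply/eqP; apply: contraT => UT.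
  have [|u [v [uU]]] := exit _ UT.
    by apply/set0Pn; exists x; rewrite inE xA.
  rewrite inE negb_or => /andP[vA vB] _ MT; exfalso.
  wlog uA : A B mA mB AF BF {Amax AT Bmax BT sA sB A0 xA xB yA yB UT}
            AB BA S0 uU vA vB / u \in A.
    by move=> W; case/setUP: (uU) => uX;
       [apply: (W A B)|apply: (W B A)] => //; rewrite 1?setIC 1?setUC.
  have AM := max_overlap mA (MinF u v) MT uA (Ml _ _) vA (Mr _ _).
  have eqS := FL AF BF (MinF u v) AB AM.
  have /set0Pn[z zS] := S0.
  have /setIP[_ zB] := zS.
  have zM : z \in M u v by move: zS; rewrite eqS => /setIP[].
  have BM := max_overlap mB (MinF u v) MT zB zM vB (Mr _ _).
  exact: (F3 AF BF (MinF u v)).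
exists A, B; split=> //.
- move=> u s s' uS sS s'S; have: u \in A :|: B by rewrite AUB inE.
  have [uA _|uA /setUP[uA'|uB]] := boolP (u \in A).
  + apply: (side_modular AF BF AB) => //.
    by move: uS; rewrite !inE uA andbT.
  + by rewrite uA' in uA.
  by apply: (side_modular BF AF BA); rewrite ?(setIC B) // inE uA.
- move=> u v /setDP[uA uB] /setDP[vB vA].
  have nuv : u != v by apply: contraNneq uB => ->.
  (* If [M u v] were proper, it would overlap both [A] and [B]. *)
  apply: r_top => //; apply/eqP; apply: contraT => MT; exfalso.
  apply: (F3 AF BF (MinF u v)) => //.
    exact: (max_overlap mA (MinF u v) MT uA (Ml _ _) vA (Mr _ _)).
  exact: (max_overlap mB (MinF u v) MT vB (Mr _ _) uB (Ml _ _)).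
move=> a b c s sS /orP[] /andP[/andP[aD bD] cD].
  exact: (side_no_path4 AF BF AB).
by apply: (side_no_path4 BF AF BA); rewrite // setIC.
Qed.

End Split.

(** All pairs whose minimal cluster is the whole set have the same adjacency. If they are adjacent,
    the complement is split, with the same clusters. *)
Lemma clustered_split (T : finType) (r : rel T) :
  symmetric r -> 1 < #|T| -> clustered r ->
  connected_rel r -> connected_rel (fun x y => (x != y) && ~~ r x y) ->
  (exists A B, split_by r A B) \/
  (exists A B, split_by (fun x y => (x != y) && ~~ r x y) A B).
Proof.
move=> rC T1 clr cr ccr; have [F [M [FL F3 MF Mmin rM]]] := clr.
have [/existsP[x /existsP[y /and3P[nxy /eqP MT rxy]]]|none] :=
  boolP [exists x, exists y, [&& x != y, M x y == setT & r x y]].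
  right; apply: (connected_split _ FL F3 MF Mmin) => //.
  - by move=> u v; rewrite eq_sym rC.
  - by move=> u v u' v' nuv nuv' /rM->; rewrite // nuv nuv'.
  move=> u v nuv uvT; rewrite nuv negbK /=.
  by rewrite (rM u v x y) // MT.
left; apply: (connected_split _ FL F3 MF Mmin) => // x y nxy MT.
apply: contra none => rxy; apply/existsP; exists x; apply/existsP; exists y.
by rewrite nxy MT eqxx.
Qed.

(** * Holes and paths on six vertices *)

Section SmallGraphs.

(* Sets of vertices are coded as bit sequences for evaluation in the kernel. *)
Fixpoint bitseqs n : seq bitseq :=
  if n is m.+1 then
    map (cons true) (bitseqs m) ++ map (cons false) (bitseqs m)
  else [:: [::]].

Lemma mem_bitseqs b : b \in bitseqs (size b).
Proof.
elim: b => //= x b IHb; rewrite mem_cat; apply/orP.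
by case: x; [left|right]; apply: map_f.
Qed.

Variables (n : nat) (r : rel nat).

Definition all_below (P : pred nat) := all P (iota 0 n).
Definition all2_below (P : rel nat) := all_below (fun i => all_below (P i)).

Definition connected_code (a : bitseq) :=
  has id a ==> all2_below (fun i j => nth false a i ==> r i j ==> nth false a j)
  ==> all id a.

(** The test [r c s], itself part of [path4], precedes the choice of the other two path vertices to
    shorten the search. *)
Definition split_code (a b : bitseq) :=
  let A := nth false a in let B := nth false b in
  let S := fun i => A i && B i in
  let dA := fun i => A i && ~~ B i in let dB := fun i => B i && ~~ A i in
  [&& all_below (fun i => A i || B i), ~~ all id a, ~~ all id b,
      ~~ all_below (fun i => ~~ S i),
      all2_below (fun i j => dA i ==> dB j ==> ~~ r i j),
      all_below (fun i => ~~ S i ==>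
        all2_below (fun j k => S j ==> S k ==> (r i j == r i k))) &
      all_below (fun s => S s ==> all_below (fun c => r c s ==>
        all2_below (fun a b => dA a && dA b && dA c || dB a && dB b && dB c ==>
          ~~ path4 r a b c s)))].

Definition obstruction_code :=
  all connected_code (bitseqs n) &&
  all (fun a => all (fun b => ~~ split_code a b) (bitseqs n)) (bitseqs n).

End SmallGraphs.

Definition co_nat (r : rel nat) : rel nat := fun i j => (i != j) && ~~ r i j.
Definition path_nat : rel nat := fun i j => (i.+1 == j) || (j.+1 == i).
Definition cycle_nat n : rel nat :=
  fun i j => (i != j) && ((i.+1 %% n == j) || (j.+1 %% n == i)).

(** * Correctness of the coded tests *)

Section Code.
Variables (n : nat) (r : rel nat) (s : rel 'I_n.+1).
Hypothesis rs : forall x y : 'I_n.+1, s x y = r x y.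

Let code (A : {set 'I_n.+1}) := mkseq (fun k => inord k \in A) n.+1.

Let codeE A (x : 'I_n.+1) : nth false (code A) x = (x \in A).
Proof. by rewrite nth_mkseq ?inord_val. Qed.

Let all_belowP (P : pred nat) :
  reflect (forall x : 'I_n.+1, P x) (all_below n.+1 P).
Proof.
apply: (iffP allP) => [all_P x|all_P k].
  by apply: all_P; rewrite mem_iota /=.
by rewrite mem_iota => /= kn; apply: (all_P (Ordinal kn)).
Qed.

Let all2_belowP (P : rel nat) :
  reflect (forall x y : 'I_n.+1, P x y) (all2_below n.+1 P).
Proof.
apply: (iffP (all_belowP _)) => [allP x y|allP x]; last exact/all_belowP.
by move/all_belowP: (allP x).
Qed.

Let code_full A : all id (code A) = (A == setT).
Proof.
apply/allP/eqP=> [all_A|-> _ /mapP[k _ ->]]; last by rewrite inE.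
apply/setP=> x; rewrite inE -codeE; apply: all_A.
by rewrite mem_nth ?size_mkseq.
Qed.

Let code_mem A : code A \in bitseqs n.+1.
Proof. by rewrite -[n.+1](size_mkseq (fun k => inord k \in A)) mem_bitseqs. Qed.

Lemma obstruction_connected : obstruction_code n.+1 r -> connected_rel s.
Proof.
case/andP=> /allP/(_ _ (code_mem _)) conn _ A /set0Pn[x xA] closedA.
have := conn A; rewrite /connected_code code_full => /implyP; move=> W.
apply/eqP; move: W; case: hasP => [_ /(_ isT)/implyP|[]]; last first.
  by exists true => //; rewrite -xA -codeE mem_nth ?size_mkseq.
apply; apply/all2_belowP=> y z; rewrite !codeE -rs.
by apply/implyP=> yA; apply/implyP; apply: closedA.
Qed.

Lemma obstruction_not_split A B : obstruction_code n.+1 r -> ~ split_by s A B.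
Proof.
case/andP=> _ /allP/(_ _ (code_mem A))/allP/(_ _ (code_mem B))/negP nsplit.
case=> [[AUB AT BT S0] modS cross noP]; apply: nsplit.
rewrite /split_code !code_full; apply/and5P; split=> //.
- by apply/all_belowP=> x; rewrite !codeE -in_setU AUB inE.
- apply/negP=> /all_belowP none; case/set0Pn: S0 => x; rewrite inE => xS.
  by have := none x; rewrite !codeE xS.
apply/and3P; split.
- apply/all2_belowP=> x y; rewrite !codeE -rs.
  by apply/implyP=> xD; apply/implyP=> yD; apply: cross; rewrite !inE andbC.
- apply/all_belowP=> x; rewrite !codeE; apply/implyP=> xS.
  apply/all2_belowP=> y z; rewrite !codeE -!rs.
  by apply/implyP=> yS; apply/implyP=> zS; apply/eqP/modS; rewrite inE.
apply/all_belowP=> x; rewrite !codeE; apply/implyP=> xS.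
apply/all_belowP=> c; apply/implyP=> _; apply/all2_belowP=> a b.
rewrite !codeE; apply/implyP=> abc.
have := noP a b c x; rewrite /path4 !rs; apply; first by rewrite inE.
by rewrite !inE; move: abc; rewrite ![_ && ~~ _]andbC.
Qed.

End Code.

(** The split given by [clustered_split] may be one of the graph or of its complement, hence two
    checks; the size [n.+2] supplies two vertices. *)
Lemma obstruction_not_clustered n (r : rel nat) (s : rel 'I_n.+2) :
  symmetric s -> (forall x y : 'I_n.+2, s x y = r x y) ->
  obstruction_code n.+2 r -> obstruction_code n.+2 (co_nat r) -> ~ clustered s.
Proof.
move=> sC rs ob cob.
have crs (x y : 'I_n.+2) : (x != y) && ~~ s x y = co_nat r x y by rewrite rs.
move/clustered_split; case.
- by [].
- by rewrite card_ord.
- exact: obstruction_connected rs ob.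
- exact: obstruction_connected crs cob.
- by case=> A [B]; apply: obstruction_not_split ob.
by case=> A [B]; apply: obstruction_not_split cob.
Qed.

Lemma path6_not_clustered : ~ clustered (@path_adj 6).
Proof.
(* With size [4.+2] both codes are closed booleans, settled by evaluation. *)
by apply: (@obstruction_not_clustered 4 path_nat) => //; apply: path_adj_sym.
Qed.

Lemma cycle_not_clustered n : 5 <= n -> ~ clustered (@cycle_adj n).
Proof.
move=> n5; have [n6|] := leqP n 6; last first.
  (* From length 7 on, the first six vertices induce a path: their successors do not wrap around
     modulo [n]. *)
  move=> n7 cl; apply: path6_not_clustered.
  pose f := widen_ord (ltnW n7).
  apply: (clustered_induced (f := f)) cl; first by move=> i j [/val_inj].
  move=> i j; rewrite /cycle_adj /path_adj -!val_eqE /=.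
  have small (k : 'I_6) : k.+1 %% n = k.+1.
    by apply: modn_small; apply: (leq_trans _ n7); rewrite ltnS ltn_ord.
  rewrite !small; apply/andb_idl.
  by case/orP=> /eqP<-; rewrite neq_ltn ltnSn ?orbT.
have [->|->] : n = 5 \/ n = 6 by case: n n5 n6 => [|[|[|[|[|[|[|n]]]]]]] //; [left|right].
  by apply: (@obstruction_not_clustered 3 (cycle_nat 5)) => //; apply: cycle_adj_sym.
by apply: (@obstruction_not_clustered 4 (cycle_nat 6)) => //; apply: cycle_adj_sym.
Qed.

Lemma clustered_no_hole G : clustered (@adj G) -> ~ has_hole G.
Proof.
move=> clG [n [n5 [f [f_inj fP]]]].
exact: (cycle_not_clustered n5 (clustered_induced f_inj fP clG)).
Qed.

Lemma clustered_no_path6 G :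
  clustered (@adj G) -> ~ contains_induced G (path_graph 6).
Proof.
move=> clG [f [f_inj fP]].
exact: (path6_not_clustered (clustered_induced f_inj fP clG)).
Qed.

(** * Clusters of galled-trees *)

Section Biconnected.
Variables (V : finType) (e : rel V).
Implicit Types A B C : {set V}.

Let adj_in A := [rel u v | [&& u \in A, v \in A & e u v || e v u]].

Lemma connected_inP A : reflect
  (forall x y, x \in A -> y \in A -> connect (adj_in A) x y) (connected_in e A).
Proof.
apply: (iffP forall_inP) => [cA x y xA yA|cA x xA].
  by move/forall_inP: (cA x xA) => /(_ y yA).
by apply/forall_inP=> y yA; apply: cA.
Qed.

Let connect_adj_inS A B x y : A \subset B ->
  connect (adj_in A) x y -> connect (adj_in B) x y.
Proof.
move=> sAB; apply: connect_sub => u v /and3P[uA vA uv]; apply: connect1.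
by rewrite /= !(subsetP sAB).
Qed.

Lemma connected_inU A B x : x \in A -> x \in B ->
  connected_in e A -> connected_in e B -> connected_in e (A :|: B).
Proof.
move=> xA xB /connected_inP cA /connected_inP cB; apply/connected_inP.
have to u : u \in A :|: B ->
    connect (adj_in (A :|: B)) u x /\ connect (adj_in (A :|: B)) x u.
  case/setUP=> uX; split.
  - by apply: connect_adj_inS (subsetUl _ _) _; apply: cA.
  - by apply: connect_adj_inS (subsetUl _ _) _; apply: cA.
  - by apply: connect_adj_inS (subsetUr _ _) _; apply: cB.
  - by apply: connect_adj_inS (subsetUr _ _) _; apply: cB.
by move=> u v /to[ux _] /to[_ xv]; apply: connect_trans xv.
Qed.

Lemma connected_in_path x p : path (fun u v => e u v || e v u) x p ->
  connected_in e [set y in x :: p].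
Proof.
elim: p x => [|y p IHp] x /=.
  move=> _; apply/connected_inP => u v; rewrite !inE => /eqP-> /eqP->.
  exact: connect0.
case/andP=> exy /IHp cp.
have -> : [set z in [:: x, y & p]] = [set x; y] :|: [set z in y :: p].
  by apply/setP=> z; rewrite !inE; case: (z == x); case: (z == y).
apply: (@connected_inU _ _ y); rewrite ?inE ?eqxx ?orbT //.
apply/connected_inP=> u v; rewrite !inE.
by do 2![case/orP=> /eqP->]; rewrite ?connect0 //; apply: connect1;
  rewrite /= !inE !eqxx ?orbT //= orbC.
Qed.

(** Once the deleted vertex is rotated to the front, the rest of the cycle is a path. *)
Lemma biconnected_cycle c : ucycle (fun u v => e u v || e v u) c ->
  biconnected e [set y in c].
Proof.
case/andP=> cyc uniqc; apply/andP; split.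
  case: c cyc {uniqc} => [_|x p]; last first.
    by rewrite /= rcons_path => /andP[xp _]; apply: connected_in_path.
  by apply/connected_inP=> x y; rewrite inE.
apply/forall_inP=> v; rewrite inE => /rot_to[i p def_p].
have -> : [set y in c] :\ v = [set y in p].
  apply/setP=> y; rewrite !inE -(mem_rot i) def_p inE.
  have: v \notin p by move: uniqc; rewrite -(rot_uniq i) def_p => /andP[].
  by case: eqP => [->|_] //= /negbTE->.
move: cyc; rewrite -(rot_cycle i) def_p /=.
case: p {def_p} => [_|x p]; first by apply/connected_inP=> x y; rewrite inE.
by rewrite /= rcons_path => /and3P[_ xp _]; apply: connected_in_path.
Qed.

Lemma biconnectedD1 C v : biconnected e C -> connected_in e (C :\ v).
Proof.
case/andP=> cC /forall_inP bC; have [/bC//|vC] := boolP (v \in C).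
suff -> : C :\ v = C by [].
by apply/setDidPl; rewrite disjoint_sym disjoints1.
Qed.

(** Deleting a vertex spares [x] or [y], which still joins the two remainders. *)
Lemma biconnectedU A B x y : x != y -> x \in A :&: B -> y \in A :&: B ->
  biconnected e A -> biconnected e B -> biconnected e (A :|: B).
Proof.
move=> nxy /setIP[xA xB] /setIP[yA yB] bA bB; apply/andP; split.
  by have [/andP[cA _] /andP[cB _]] := (bA, bB); apply: (connected_inU xA xB).
apply/forall_inP=> v _; rewrite setDUl.
have [xv|xv] := eqVneq x v.
  by apply: (@connected_inU _ _ y); rewrite ?biconnectedD1 // !inE -xv eq_sym nxy.
by apply: (@connected_inU _ _ x); rewrite ?biconnectedD1 // !inE xv.
Qed.

End Biconnected.

(** * Reachability in acyclic digraphs *)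

Section Acyclic.
Variables (V : finType) (e : rel V).
Hypothesis e_acy : acyclic e.

Lemma acyclic_arc x y : e x y -> ~~ connect e y x.
Proof.
move=> exy; apply/negP=> /connectP[p0 yp0 lastp0].
move: exy; rewrite lastp0; case/shortenP: yp0 => p yp up _ exy.
suff: y :: p = [::] by [].
by apply: e_acy; apply/andP; rewrite /= rcons_path yp exy.
Qed.

Lemma acyclic_anti x y : connect e x y -> connect e y x -> x = y.
Proof.
move=> /connectP[[|z p] /=]; first by move=> _ ->.
move=> /andP[exz zp] -> px; case/negP: (acyclic_arc exz).
by apply: connect_trans px; apply/connectP; exists p.
Qed.

Lemma acyclic_path_uniq x p : path e x p -> uniq (x :: p).
Proof.
elim: p x => //= y p IHp x /andP[exy yp].
apply/andP; split; last exact: IHp.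
apply/negP=> xp.
case/negP: (acyclic_arc exy); move: xp; rewrite inE => /predU1P[->|xp].
  exact: connect0.
have /allP := order_path_min (@connect_trans _ e) (sub_path (@connect1 _ e) yp).
exact.
Qed.

Definition desc v := [set w | connect e v w].

Lemma desc_sub u v : connect e u v -> desc v \subset desc u.
Proof.
by move=> uv; apply/subsetP=> w; rewrite !inE; apply: connect_trans.
Qed.

Lemma desc_subE u v : (desc v \subset desc u) = connect e u v.
Proof.
apply/idP/idP=> [/subsetP/(_ v)|]; last exact: desc_sub.
by rewrite !inE connect0; apply.
Qed.

Lemma desc_inj : injective desc.
Proof.
by move=> u v uv; apply: acyclic_anti; rewrite -desc_subE uv.
Qed.

(** The witness has fewest descendants among the vertices satisfying [P]; by [desc_inj] nothing
    strictly below it satisfies [P]. *)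
Lemma minimal_desc (P : pred V) x : P x ->
  exists2 m, P m & forall y, P y -> connect e m y -> y = m.
Proof.
move=> Px; have [m Pm mmin] := arg_minnP (fun v => #|desc v|) Px.
exists m => // y Py my; apply: desc_inj; apply/eqP.
by rewrite eqEcard desc_sub // mmin.
Qed.

Lemma maximal_desc (P : pred V) x : P x ->
  exists2 m, P m & forall y, P y -> connect e y m -> y = m.
Proof.
move=> Px; have [m Pm mmax] := arg_maxnP (fun v => #|desc v|) Px.
exists m => // y Py ym; apply: desc_inj; apply/esym/eqP.
by rewrite eqEcard desc_sub //; apply: mmax.
Qed.

Lemma path_connect x p y : path e x p -> y \in p ->
  connect e x y /\ connect e y (last x p).
Proof.
move=> xp yp; case/splitPr: yp xp => p1 p2; rewrite cat_path last_cat /=.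
case/and3P=> xp1 ey yp2; split; last by apply/connectP; exists p2.
by apply: connect_trans (connect1 ey); apply/connectP; exists p1.
Qed.

(** Paths from [g] to [u] and from [u] to [h] are joined; acyclicity makes the result simple, so the
    interior [p] avoids both ends. *)
Lemma path_via g u h : connect e g u -> connect e u h -> u != g -> u != h ->
  exists p, [/\ path e g (rcons p h), u \in p &
    forall y, y \in p -> [/\ connect e g y, connect e y h, y != g, y != h &
                            connect e y u || connect e u y]].
Proof.
move=> /connectP[p1 gp1 uE] /connectP[p2 up2 hE] nug nuh.
have [p2' p2E] : exists p2', p2 = rcons p2' h.
  case/lastP: p2 hE {up2} => [|p2 z]; first by move=> hu; rewrite hu eqxx in nuh.
  by rewrite last_rcons => ->; exists p2.
have full : path e g (rcons (p1 ++ p2') h).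
  by rewrite rcons_cat -p2E cat_path gp1 -uE.
exists (p1 ++ p2'); split=> //.
  rewrite mem_cat; apply/orP; left; move: nug; rewrite uE.
  by case: (p1) => [|z s]; rewrite /= ?eqxx ?mem_last.
have := acyclic_path_uniq full.
rewrite -rcons_cons rcons_uniq /= inE negb_or => /and3P[/andP[hg hp] gp _].
move=> y yp; have yp' : y \in rcons (p1 ++ p2') h by rewrite mem_rcons inE yp orbT.
have [gy] := path_connect full yp'; rewrite last_rcons => yh.
split=> //; first by apply: contraNneq gp => <-.
  by apply: contraNneq hp => <-.
move: yp; rewrite mem_cat => /orP[yp1|yp2].
  by have [_] := path_connect gp1 yp1; rewrite -uE => ->.
have y2 : y \in p2 by rewrite p2E mem_rcons inE yp2 orbT.
by have [-> _] := path_connect up2 y2; rewrite orbT.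
Qed.

(** * Galls and intersections of descendant sets *)

Section Galled.
Variable root : V.
Hypothesis root_conn : forall v, connect e root v.
Hypothesis indeg_hybrid : forall v, 2 <= indeg e v -> hybrid e v.
Hypothesis block_hybrid : forall C, biconnected_component e C ->
  #|[set v in C | hybrid e v && (in_nbrs e v \subset C)]| <= 1.

(** [C] need be neither a cycle nor maximal: it only has to place [h] among the hybrids counted in
    any component containing [C]. *)
Definition gall h (C : {set V}) :=
  [&& biconnected e C, hybrid e h, h \in C & in_nbrs e h \subset C].

(** Sharing two vertices makes the union biconnected, so one component contains both galls, and it
    admits only one such hybrid. *)
Lemma gall_uniq h h' C C' x y : gall h C -> gall h' C' -> x != y ->
  x \in C :&: C' -> y \in C :&: C' -> h = h'.
Proof.
move=> /and4P[bC hh hC nC] /and4P[bC' hh' hC' nC'] nxy xI yI.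
have [D maxD /subsetP sD] := maxset_exists (biconnectedU nxy xI yI bC bC').
have mem_D k (B : {set V}) : hybrid e k -> k \in B -> in_nbrs e k \subset B ->
    B \subset C :|: C' -> k \in [set v in D | hybrid e v && (in_nbrs e v \subset D)].
  move=> hk kB nB sB; rewrite inE hk sD ?(subsetP sB) //=.
  by apply: (subset_trans nB); apply: (subset_trans sB); apply/subsetP.
have /card_le1_eqP := block_hybrid maxD; apply.
  exact: mem_D hh' hC' nC' (subsetUr _ _).
exact: mem_D hh hC nC (subsetUl _ _).
Qed.

Definition incomp u v := ~~ connect e u v && ~~ connect e v u.

Lemma incompC u v : incomp u v = incomp v u.
Proof. exact: andbC. Qed.

(** Going down along [p] and back up along [q] gives an undirected cycle. The two last vertices are
    distinct, hence all the in-neighbours of [h]; [last g p] is [g] if [p] is empty. *)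
Lemma disjoint_paths_gall g h p q :
  path e g (rcons p h) -> path e g (rcons q h) -> last g p != last g q ->
  ~~ has (mem p) q -> gall h [set y in g :: p ++ h :: rev q].
Proof.
move=> gp gq pq dpq; set C := [set y in _].
have := acyclic_path_uniq gp; have := acyclic_path_uniq gq.
rewrite /= mem_rcons inE negb_or rcons_uniq => /andP[/andP[gh gq'] /andP[hq uq]].
rewrite mem_rcons inE negb_or rcons_uniq => /andP[/andP[_ gp'] /andP[hp up]].
move: (gp) (gq); rewrite !rcons_path => /andP[gp1 eph] /andP[gq1 eqh].
have bC : biconnected e C.
  apply: biconnected_cycle; apply/andP; split.
    rewrite /= rcons_cat cat_path /=.
    have -> : path (fun u v => e u v || e v u) g p.
      by apply: sub_path gp1 => u v ->.
    rewrite eph /= -rev_cons.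
    have := rev_path (fun u v => e u v || e v u) g (rcons q h).
    rewrite last_rcons belast_rcons => ->.
    by apply: sub_path gq => u v uv; rewrite /= uv orbT.
  rewrite /= mem_cat inE mem_rev !negb_or gp' gh gq' /= cat_uniq up /= mem_rev hq.
  rewrite rev_uniq uq (negbTE hp) /= andbT.
  by apply: contra dpq => /hasP[z]; rewrite mem_rev => zq zp; apply/hasP; exists z.
have lastin (s : seq V) : last g s \in g :: s by exact: mem_last.
have sub2 : [set last g p; last g q] \subset in_nbrs e h.
  by apply/subsetP=> z /set2P[]->; rewrite inE.
have hh : hybrid e h.
  by apply: indeg_hybrid; apply: leq_trans (subset_leq_card sub2); rewrite cards2 pq.
have eqn : [set last g p; last g q] = in_nbrs e h.
  have /andP[/eqP hi _] := hh; apply/eqP; rewrite eqEcard sub2 cards2 pq.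
  by rewrite /indeg in hi; rewrite hi.
apply/and4P; split=> //; first by rewrite !inE mem_cat inE eqxx !orbT.
rewrite -eqn; apply/subsetP=> z /set2P[]->.
  by have:= lastin p; rewrite !inE mem_cat => /orP[]->; rewrite ?orbT.
by have:= lastin q; rewrite !inE mem_cat inE mem_rev => /orP[]->; rewrite ?orbT.
Qed.

(* The cycle runs from a lowest common ancestor of u and v down to a highest
   common descendant above x. *)
Lemma incomp_gall u v x : incomp u v -> connect e u x -> connect e v x ->
  exists h C, [/\ gall h C, u \in C /\ v \in C,
    connect e u h /\ connect e v h, connect e h x &
    exists2 w, e w u & w \in C].
Proof.
move=> /andP[nuv nvu] ux vx.
have [|g /andP[gu gv] gmin] :=
    @minimal_desc (fun g => connect e g u && connect e g v) root.
  by rewrite !root_conn.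
have [|h /and3P[uh vh hx] hmax] :=
    @maximal_desc (fun h => [&& connect e u h, connect e v h & connect e h x]) x.
  by rewrite ux vx connect0.
have ug : u != g by apply: contraNneq nuv => ->.
have vg : v != g by apply: contraNneq nvu => ->.
have nuh : u != h by apply: contraNneq nvu => ->.
have nvh : v != h by apply: contraNneq nuv => ->.
have [p [gp up pP]] := path_via gu uh ug nuh.
have [q [gq vq qP]] := path_via gv vh vg nvh.
(* A common interior vertex above both [u] and [v] contradicts the choice of [g], one below both
   that of [h]; one in between makes [u] and [v] comparable. *)
have dis : ~~ has (mem p) q.
  apply/hasPn=> y /qP[_ yh yg ynh yv]; apply/negP=> /pP[gy _ _ _ yu].
  case/orP: yu => yu; case/orP: yv => yv.
  - by rewrite (gmin y) ?yu ?eqxx in yg.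
  - by rewrite (connect_trans yv yu) in nvu.
  - by rewrite (connect_trans yu yv) in nuv.
  by rewrite (hmax y) ?yu ?yv ?eqxx ?(connect_trans yh hx) in ynh.
have lastin (s : seq V) z : z \in s -> last g s \in s.
  by case: s => //= y s _; apply: mem_last.
have pq : last g p != last g q.
  apply: contra dis => /eqP pq; apply/hasP; exists (last g q); first exact: lastin vq.
  by rewrite -pq; apply: lastin up.
exists h, [set y in g :: p ++ h :: rev q]; split=> //.
- exact: disjoint_paths_gall.
- by split; rewrite !inE !mem_cat ?up ?orbT // inE mem_rev vq !orbT.
(* The in-neighbour of [u] is its predecessor on the first path. *)
case/splitPr: up gp => p1 p2; rewrite rcons_cat cat_path /= => /and3P[_ eu _].
exists (last g p1) => //; rewrite !inE !mem_cat.
by have := mem_last g p1; rewrite inE => /orP[]->; rewrite ?orbT.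
Qed.

(** Each common descendant lies below the sink of a gall through [u] and [v]; two such galls share
    [u] and [v], so their sinks agree. *)
Lemma incomp_desc u v x : incomp u v -> connect e u x -> connect e v x ->
  exists h C, [/\ gall h C, u \in C /\ v \in C, exists2 w, e w u & w \in C &
    desc u :&: desc v = desc h].
Proof.
move=> uv ux vx; have [h [C [hC [uC vC] [uh vh] hx wP]]] := incomp_gall uv ux vx.
exists h, C; split=> //; apply/setP=> y; rewrite !inE.
apply/andP/idP=> [[uy vy]|hy]; last by rewrite !(connect_trans _ hy).
have [h' [C' [hC' [uC' vC'] _ hy _]]] := incomp_gall uv uy vy.
suff -> : h = h' by [].
apply: (gall_uniq hC hC' (x := u) (y := v)); rewrite ?inE ?uC ?vC //.
by apply: contraTneq uv => ->; rewrite /incomp connect0.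
Qed.

(** Paths to the two in-neighbours from a minimal common ancestor [g] of them meet only in [g]. *)
Lemma hybrid_gall v : hybrid e v -> exists C, gall v C.
Proof.
move=> hv; have /andP[/cards2P[a [b [nab vE]]] _] := hv.
have [ea eb] : e a v /\ e b v.
  by have:= in_set2 a a b; have:= in_set2 b a b; rewrite -vE !inE !eqxx orbT.
have [|g /andP[ga gb] gmin] :=
    @minimal_desc (fun g => connect e g a && connect e g b) root.
  by rewrite !root_conn.
have /connectP[p gp lp] := ga; have /connectP[q gq lq] := gb.
exists [set y in g :: p ++ v :: rev q]; apply: disjoint_paths_gall.
- by rewrite rcons_path gp -lp.
- by rewrite rcons_path gq -lq.
- by rewrite -lp -lq.
apply/hasPn=> y yq; apply/negP=> /= yp.
have [gy ya] := path_connect gp yp; have [_ yb] := path_connect gq yq.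
have yg : y = g by apply: gmin => //; rewrite lp ya lq.
by have /andP[/negP[]] := acyclic_path_uniq gp; rewrite -yg.
Qed.

(** The galls of both pairs contain [u] and its only in-neighbour, so they have the same sink. *)
Lemma incomp_desc_eq u v w : incomp u v -> incomp u w ->
  desc u :&: desc v != set0 -> desc u :&: desc w != set0 ->
  desc u :&: desc v = desc u :&: desc w.
Proof.
move=> uv uw /set0Pn[x]; rewrite !inE => /andP[ux vx].
move=> /set0Pn[y]; rewrite !inE => /andP[uy wy].
have [h [C [hC [uC _] [a ea aC] hE]]] := incomp_desc uv ux vx.
have [h' [C' [hC' [uC' _] [a' ea' aC'] h'E]]] := incomp_desc uw uy wy.
have neq b : e b u -> b != u.
  by move=> eb; apply: contraTneq (acyclic_arc eb) => ->; rewrite connect0.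
(* If [u] were hybrid, its own gall would share the arc from [a] to [u] with [C]; then [h] is [u],
   which puts [v] above [u]. *)
have nhu : ~~ hybrid e u.
  apply/negP=> /hybrid_gall[B uB]; have /and4P[_ _ uinB /subsetP nB] := uB.
  have hu : h = u.
    apply: (gall_uniq hC uB (neq a ea)); rewrite inE ?aC ?uC //.
    by rewrite nB // inE.
  have: h \in desc u :&: desc v by rewrite hE inE connect0.
  by rewrite !inE hu => /andP[_ vu]; rewrite /incomp vu andbF in uv.
have aa' : a = a'.
  have : #|in_nbrs e u| <= 1.
    by rewrite leqNgt; apply: contra nhu; apply: indeg_hybrid.
  by move/card_le1_eqP; apply; rewrite inE.
rewrite hE h'E; congr desc; apply: (gall_uniq hC hC' (neq a ea)).
  by rewrite inE aC aa'.
by rewrite inE uC.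
Qed.

(** All three intersections equal [desc h]. Each vertex lies above one of the two in-neighbours of
    [h], so two lie above the same one, which would then be a descendant of [h]. *)
Lemma no_three_incomp u v w : incomp u v -> incomp u w -> incomp v w ->
  desc u :&: desc v != set0 -> desc u :&: desc w != set0 ->
  desc v :&: desc w != set0 -> False.
Proof.
move=> uv uw vw uv0 uw0 vw0.
have E1 := incomp_desc_eq uv uw uv0 uw0.
have E2 : desc v :&: desc u = desc v :&: desc w.
  by apply: incomp_desc_eq; rewrite // 1?incompC // setIC.
have /set0Pn[x] := uv0; rewrite !inE => /andP[ux vx].
have [h [C [hC _ _ hE]]] := incomp_desc uv ux vx.
have hE' : desc u :&: desc w = desc h by rewrite -E1.
have hE'' : desc v :&: desc w = desc h by rewrite -E2 setIC.
have /and4P[_ /andP[/eqP hi _] _ _] := hC.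
have /eqP/cards2P[a [b [_ nE]]] := hi.
have above z z' : incomp z z' -> desc z :&: desc z' = desc h ->
    connect e z a || connect e z b.
  move=> zz' zE; have : h \in desc z :&: desc z' by rewrite zE inE connect0.
  rewrite !inE => /andP[/connectP[p0 zp lp] z'h]; case/lastP: p0 zp lp => [|p c].
    by move=> _ /= hz; rewrite /incomp -hz z'h andbF in zz'.
  rewrite rcons_path last_rcons => /andP[zp ec] hc; rewrite -hc in ec.
  have zc : connect e z (last z p) by apply/connectP; exists p.
  have : last z p \in [set a; b] by rewrite -nE inE.
  by case/set2P=> <-; rewrite zc ?orbT.
have two z z' c : desc z :&: desc z' = desc h -> c \in [set a; b] ->
    connect e z c -> connect e z' c -> False.
  rewrite -nE inE => zE ec zc z'c; case/negP: (acyclic_arc ec).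
  have : c \in desc z :&: desc z' by rewrite !inE zc.
  by rewrite zE inE.
have [ain bin] : a \in [set a; b] /\ b \in [set a; b] by rewrite !inE !eqxx orbT.
have wu : incomp w u by rewrite incompC.
have wE : desc w :&: desc u = desc h by rewrite setIC.
case/orP: (above u v uv hE) => ua; case/orP: (above v w vw hE'') => va;
  case/orP: (above w u wu wE) => wa;
  by [apply: (two u v a) | apply: (two u v b) | apply: (two u w a)
     | apply: (two u w b) | apply: (two v w a) | apply: (two v w b)].
Qed.

Lemma overlap_desc u v :
  overlap (desc u) (desc v) = incomp u v && (desc u :&: desc v != set0).
Proof. by rewrite /overlap !desc_subE andbC /incomp; congr (_ && _); rewrite andbC. Qed.

(** If [z] is not above a minimal common ancestor [w], their common descendants form some [desc h]
    containing [x] and [y]; minimality gives that [h] is [w], so [z] is above [w] after all. *)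
Lemma lowest_common_ancestor x y : exists w,
  [/\ connect e w x, connect e w y &
      forall z, connect e z x -> connect e z y -> connect e z w].
Proof.
have [|w /andP[wx wy] wmin] :=
    @minimal_desc (fun g => connect e g x && connect e g y) root.
  by rewrite !root_conn.
exists w; split=> // z zx zy; apply: contraT => nzw.
have nwz : ~~ connect e w z.
  by apply: contra nzw => wz; rewrite (wmin z) ?connect0 ?zx.
have [|h [C [_ _ _ hE]]] := incomp_desc _ zx wx; first exact/andP.
have mem_h v : (v \in desc h) = connect e z v && connect e w v.
  by rewrite -hE !inE.
have := mem_h h; rewrite inE connect0 => /esym/andP[zh wh].
case/negP: nzw; rewrite -(wmin h) // -!(in_set (connect e h)).
by have := mem_h x; have := mem_h y; rewrite zx zy wx wy !inE => -> ->.
Qed.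

Lemma lca_lowest x y w : connect e w x -> connect e w y ->
  (forall z, connect e z x -> connect e z y -> connect e z w) ->
  lca e x y = Some w.
Proof.
move=> wx wy wmin; rewrite /lca; case: pickP => [z|/(_ w)]; last first.
  rewrite /is_lca /common_ancestor wx wy /= => /forallP[] z; apply/implyP.
  move=> /andP[zx zy]; apply/implyP=> wz; apply/eqP/acyclic_anti => //.
  exact: wmin.
case/andP=> /andP[zx zy] /forallP/(_ w); rewrite /common_ancestor wx wy /=.
by rewrite wmin // => /eqP->.
Qed.

Lemma galled_clustered (X : {set V}) (t : V -> label) :
  clustered (@explained_adj V e X t).
Proof.
have [f fP] : exists f : V -> V -> V, forall x y, [/\ connect e (f x y) x,
    connect e (f x y) y &
    forall z, connect e z x -> connect e z y -> connect e z (f x y)].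
  pose P x y w := [&& connect e w x, connect e w y &
    [forall z, connect e z x ==> connect e z y ==> connect e z w]].
  (* The default [x] is never taken, as a lowest common ancestor exists. *)
  exists (fun x y => odflt x [pick w | P x y w]) => x y.
  case: pickP => [w /and3P[wx wy /forallP wP]|none] /=.
    split=> // z zx zy; by have := wP z; rewrite zx zy.
  have [w [wx wy wP]] := lowest_common_ancestor x y.
  case/negP: (negbT (none w)); rewrite /P wx wy; apply/forallP=> z.
  by apply/implyP=> zx; apply/implyP; apply: wP.
(* Adjacency is extended from [X] to all vertices, where the descendant sets themselves are the
   clusters. *)
apply: (@clustered_induced _ _ (fun x y => (x != y) && is_one (t (f x y)))
  _ val val_inj).
  move=> x y; rewrite /explained_adj (inj_eq val_inj); congr (_ && _).
  by have [fx fy fmin] := fP (val x) (val y); rewrite (lca_lowest fx fy fmin).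
exists [set desc v | v : V], (fun x y => desc (f x y)); split.
- move=> _ _ _ /imsetP[u _ ->] /imsetP[v _ ->] /imsetP[w _ ->].
  rewrite !overlap_desc => /andP[uv uv0] /andP[uw uw0].
  exact: incomp_desc_eq.
- move=> _ _ _ /imsetP[u _ ->] /imsetP[v _ ->] /imsetP[w _ ->].
  rewrite !overlap_desc => /andP[uv uv0] /andP[uw uw0] /andP[vw vw0].
  exact: (no_three_incomp uv uw vw).
- by move=> x y; have [fx fy _] := fP x y; rewrite !inE imset_f.
- move=> x y _ /imsetP[v _ ->]; rewrite !inE => vx vy.
  by have [_ _ fmin] := fP x y; apply/desc_sub/fmin.
by move=> x y x' y' -> -> /desc_inj ->.
Qed.

End Galled.

(** A topmost ancestor of [v] has no in-neighbour, so it is [r]. *)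
Lemma acyclic_root_connect r : (forall v, indeg e v = 0 -> v = r) ->
  forall v, connect e r v.
Proof.
move=> r_uniq v; have [m mv mmax] := maximal_desc (connect0 e v : connect e ^~ v v).
suff <- : m = r by [].
apply: r_uniq; apply: eq_card0 => u; rewrite inE; apply/negP=> eum.
case/negP: (acyclic_arc eum).
suff -> : u = m by apply: connect0.
by apply: mmax (connect1 eum); apply: connect_trans mv; apply: connect1.
Qed.

End Acyclic.

Lemma GaTEx_clustered G : GaTEx G -> clustered (@adj G).
Proof.
move=> [V [e [X [t [[[_ e_acy shape] _] [f [f_bij fP]]]]]]].
apply: (clustered_induced (bij_inj f_bij) fP) => /=.
case: shape => [[x [VE _ none]]|[r [[r0 _ r_uniq] XP VP blocks]]].
  apply: (galled_clustered e_acy (root := x)).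
  - by move=> v; have:= in_setT v; rewrite VE => /set1P->; apply: connect0.
  - move=> v; rewrite /indeg (_ : in_nbrs e v = set0) ?cards0 //.
    by apply/setP=> u; rewrite !inE (negbTE (none u v)).
  move=> C _; apply: leq_trans (subset_leq_card (subsetT _)) _.
  by rewrite VE cards1.
apply: (galled_clustered e_acy (acyclic_root_connect e_acy r_uniq) _ blocks).
(* Indegree at least 2 rules out leaves and the root, so (N3) makes [v] hybrid. *)
move=> v v2; have vX : v \notin X.
  by apply/negP=> /XP[_ v1]; rewrite v1 in v2.
have vr : v <> r by move=> vr; rewrite vr r0 in v2.
case: (VP v vX vr) => [[v1 _]|[vi vo]]; first by rewrite v1 in v2.
by rewrite /hybrid vi vo.
Qed.

Theorem mainTheorem7 (G : sgraph) (hG : GaTEx G) : murky G.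
Proof.
have clG := GaTEx_clustered hG.
have clC : clustered (@adj (complement G)) := clustered_compl clG.
by split; [apply: clustered_no_hole|apply: clustered_no_hole
          |apply: clustered_no_path6|apply: clustered_no_path6].
Qed.
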